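(* Let $G$ be a finite simple strongly connected directed graph on $n$ vertices and set $\tau(v)=\lceil (\deg^{in}(v)+1)/2\rceil$ for every vertex $v$ of $G$. Then the smallest size of a dynamic monopoly for $(G,\tau)$ is at most $\lceil n/2\rceil$. Moreover, if $G$ contains at least one vertex of odd in-degree, then $(G,\tau)$ has a dynamic monopoly with no more than $n/2$ vertices.
   Context: A directed graph is simple if it has no loops and there is at most one edge between any two vertices (in particular there is no directed cycle of length two). It is strongly connected if for any two distinct vertices $u,v$ there is a directed path from $u$ to $v$. $\deg^{in}(v)$ denotes the in-degree of $v$, i.e. the number of vertices $u$ such that there is an edge from $u$ to $v$. Given a directed graph $G$ and a threshold assignment $\tau:V(G)\to\mathbb{N}$, a subset $M\subseteq V(G)$ is a dynamic monopoly (dynamo) for $(G,\tau)$ if $V(G)$ can be partitioned as $D_0\cup D_1\cup\dots\cup D_t$ with $D_0=M$ such that for every $i\ge 1$ and every $v\in D_i$, the number of edges from $D_0\cup\dots\cup D_{i-1}$ to $v$ is at least $\tau(v)$. *)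

(* Defs.v *)
From mathcomp Require Import all_boot.

Set Implicit Arguments.
Unset Strict Implicit.
Unset Printing Implicit Defensive.

(* A finite directed graph is a finType T of vertices with a relation e, where
   e u v means that there is an edge from u to v. *)

(* At most one edge between any two vertices, in either direction. *)
Definition simple_digraph (T : finType) (e : rel T) : Prop :=
  irreflexive e /\ (forall u v : T, ~~ (e u v && e v u)).

Definition strongly_connected (T : finType) (e : rel T) : Prop :=
  forall u v : T, u != v -> connect e u v.

Definition indeg (T : finType) (e : rel T) (v : T) : nat := #|[set u | e u v]|.

(* The blocks D i may be empty: dropping the empty ones of index i >= 1 does not
   affect the other conditions. *)
Definition dynamo (T : finType) (e : rel T) (tau : T -> nat) (M : {set T}) :
    Prop :=
  exists (t : nat) (D : 'I_t.+1 -> {set T}),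
    [/\ D ord0 = M,
        \bigcup_i D i = [set: T],
        forall i j, i != j -> [disjoint D i & D j]
      & forall (i : 'I_t.+1) (v : T), 0 < i -> v \in D i ->
          tau v <= #|[set u in \bigcup_(j < t.+1 | j < i) D j | e u v]|].

Definition smallest_dynamo_size (T : finType) (e : rel T) (tau : T -> nat)
    (k : nat) : Prop :=
  (exists M : {set T}, dynamo e tau M /\ #|M| = k) /\
  (forall M : {set T}, dynamo e tau M -> k <= #|M|).

(* uphalf m is the ceiling of m / 2. *)
Definition strict_majority (T : finType) (e : rel T) (v : T) : nat :=
  uphalf (indeg e v + 1).

(* Main.v *)
(* Call a set A of vertices activable if its complement is a dynamo. Adding to A
   a vertex v with fewer than half of its in-neighbours in A keeps A activable:
   v is activated first. Fix a vertex r. By strong connectivity the vertices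
   other than r can be enumerated so that each has an in-neighbour occurring
   later (r counting as the last one); hence each of them in turn can be added
   to one of two disjoint activable sets A, B. At the end A and B cover
   everything but r, and r can be added as well if its in-degree is odd. The
   smaller of the complements of A and B is the required dynamo. *)
Require Import Defs.
From mathcomp Require Import all_boot.
From mathcomp Require Import zify.
From Stdlib Require Import Classical.

Set Implicit Arguments.
Unset Strict Implicit.
Unset Printing Implicit Defensive.

Section StrictMajority.
Variables (T : finType) (e : rel T).
Hypothesis eI : irreflexive e.

(** [f] gives activation times, with time 0 for the initial set [~: A]. The bound is the threshold
    test in doubled form: [uphalf (d + 1) <= k] exactly when [d < 2 * k]. Times may skip values. *)
Definition activable (A : {set T}) : Prop :=
  exists f : T -> nat, (forall v, (v \in A) = (0 < f v)) /\
    (forall v, v \in A -> indeg e v < 2 * #|[set u | e u v & f u < f v]|).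

Lemma activable_dynamo (A : {set T}) :
  activable A -> dynamo e (strict_majority e) (~: A).
Proof.
case=> f [fA fP].
have ltf v : f v < (\max_u f u).+1 by rewrite ltnS leq_bigmax.
exists (\max_u f u), (fun i : 'I_(\max_u f u).+1 => [set v | f v == i]); split.
- by apply/setP=> v; rewrite !inE fA lt0n negbK.
- apply/setP=> v; rewrite inE; apply/bigcupP.
  by exists (Ordinal (ltf v)); rewrite ?inE.
- move=> i j ij; apply/pred0P=> v /=; rewrite !inE.
  by apply: contraNF ij => /andP[/eqP fi /eqP fj]; rewrite -val_eqE /= -fi fj.
move=> i v i0; rewrite inE => /eqP fv.
rewrite /strict_majority leq_uphalf_double addn1 -mul2n.
apply: leq_trans (fP v _) _; first by rewrite fA fv.
rewrite leq_mul2l /=; apply/subset_leq_card/subsetP=> u; rewrite !inE.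
case/andP=> -> fuv; rewrite andbT; apply/bigcupP.
by exists (Ordinal (ltf u)); rewrite ?inE //= -fv.
Qed.

Lemma activable0 : activable set0.
Proof. by exists (fun=> 0); split=> v; rewrite inE. Qed.

Lemma indeg_split (A : {set T}) (v : T) :
  indeg e v = #|[set u in A | e u v]| + #|[set u | e u v & u \notin A]|.
Proof.
rewrite /indeg -(cardsID A); congr (_ + _); apply: eq_card => u;
  by rewrite !inE andbC.
Qed.

Lemma activableU1 (A : {set T}) (v : T) :
  2 * #|[set u in A | e u v]| < indeg e v -> activable A ->
  activable (v |: A).
Proof.
have [vA|vA ltd] := boolP (v \in A).
  by rewrite (setUidPr _) // sub1set.
case=> f [fA fP].
(* Time 1 is freed for [v] by delaying all positive times by one. The in-neighbours of [v] at time 0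
   are then those outside [A], and no earlier-than relation inside [A] or from [~: A] is lost. *)
exists (fun u => if u == v then 1 else if f u == 0 then 0 else (f u).+1).
split=> w; rewrite !inE.
  by case: eqP => //= _; rewrite fA; case: (f w).
have [-> _|wv /= wA] := eqVneq w v.
  have -> : [set u | e u v & (if u == v then 1 else
      if f u == 0 then 0 else (f u).+1) < 1] = [set u | e u v & u \notin A].
    apply/setP=> u; rewrite !inE fA; case: eqP => [->|_]; first by rewrite eI.
    by case: (f u).
  by have := indeg_split A v; lia.
have fw : 0 < f w by rewrite -fA.
apply: leq_trans (fP w wA) _; rewrite leq_mul2l /=.
apply/subset_leq_card/subsetP=> u; rewrite !inE => /andP[-> fuw] /=.
(* If [u] is [v], its new time 1 is still below the new time of [w], which is at least 2. *)
rewrite (gtn_eqF fw).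
by case: eqP => // _; case: (f u) fuw.
Qed.

Definition splittable (X : {set T}) : Prop :=
  exists A B : {set T}, [/\ activable A, activable B, A :&: B = set0
    & A :|: B = X].

(** If [v] could join neither part, each would hold at least half of its in-neighbours. The parts
    being disjoint, each would hold exactly half and none would lie outside [X]; an odd in-degree
    excludes this too. *)
Lemma splittableU1 (X : {set T}) (v : T) :
  v \notin X -> (exists2 u, e u v & u \notin X) \/ odd (indeg e v) ->
  splittable X -> splittable (v |: X).
Proof.
move=> vX hv [A [B [actA actB AB0 ABX]]].
have vA : v \notin A by apply: contra vX; rewrite -ABX inE => ->.
have vB : v \notin B by apply: contra vX; rewrite -ABX inE orbC => ->.
set a := #|[set u in A | e u v]|; set b := #|[set u in B | e u v]|.
have ab : a + b = #|[set u in X | e u v]|.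
  have -> : [set u in X | e u v] = [set u in A | e u v] :|: [set u in B | e u v].
    by apply/setP=> u; rewrite -ABX !inE andb_orl.
  rewrite cardsU; have -> : [set u in A | e u v] :&: [set u in B | e u v] = set0.
    apply/setP=> u; have /setP/(_ u) := AB0; rewrite !inE.
    by case: (u \in A); case: (u \in B); case: (e u v).
  by rewrite cards0 subn0.
have : (2 * a < indeg e v) || (2 * b < indeg e v).
  have := indeg_split X v; rewrite -ab.
  case: hv => [[u uv uX]|]; last by lia.
  suff : 0 < #|[set u | e u v & u \notin X]| by lia.
  by apply/card_gt0P; exists u; rewrite inE uv.
case/orP=> lt.
- exists (v |: A), B; split=> //; first exact: activableU1.
    rewrite setIUl AB0 setU0; apply/eqP; rewrite setI_eq0 disjoints1.
    exact: vB.
  by rewrite -setUA ABX.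
exists A, (v |: B); split=> //; first exact: activableU1.
  rewrite setIUr AB0 setU0; apply/eqP; rewrite setIC setI_eq0 disjoints1.
  exact: vA.
by rewrite setUCA ABX.
Qed.

Lemma connect_exit (W : {set T}) (r x : T) :
  connect e r x -> r \in W -> x \notin W ->
  exists u v, [/\ u \in W, v \notin W & e u v].
Proof.
case/connectP=> p; elim: p r => [|y p IHp] r /=; first by move=> _ -> ->.
case/andP=> ry yp xE rW xW; have [yW|yW] := boolP (y \in W).
  exact: IHp yp xE yW xW.
by exists r, y.
Qed.

(** The enumeration is built backwards: [W] grows from [r] along an edge from [u] to [v] leaving it.
    The vertex [v] is added to the parts last, while [u] is still outside them. *)
Lemma splittable_setC (r : T) (W : {set T}) :
  strongly_connected e -> r \in W -> splittable (~: W).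
Proof.
move=> scon; have [n] := ubnP #|~: W|; elim: n W => // n IHn W leWn rW.
have [/eqP ->|/set0Pn[x]] := boolP (~: W == set0).
  by exists set0, set0; split; rewrite ?setI0 ?setU0 //; exact: activable0.
rewrite inE => xW.
have rx : r != x by apply: contraNneq xW => <-.
have [u [v [uW vW uv]]] := connect_exit (scon r x rx) rW xW.
have WE : ~: W = v |: ~: (v |: W).
  by apply/setP=> y; rewrite !inE; case: eqP => [->|].
rewrite WE; apply: splittableU1; first by rewrite !inE eqxx.
  by left; exists u => //; rewrite !inE uW orbT.
apply: IHn; last by rewrite inE rW orbT.
by move: leWn; rewrite WE cardsU1 !inE eqxx.
Qed.

Lemma splittable_dynamo (X : {set T}) : splittable X ->
  exists M : {set T}, dynamo e (strict_majority e) M /\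
    2 * #|M| + #|X| <= 2 * #|T|.
Proof.
case=> A [B [actA actB AB0 <-]].
rewrite cardsU AB0 cards0 subn0.
have := cardsC A; have := cardsC B.
have [le|lt] := leqP #|A| #|B|.
  by exists (~: B); split; [exact: activable_dynamo | lia].
by exists (~: A); split; [exact: activable_dynamo | lia].
Qed.

End StrictMajority.

Lemma smallest_dynamo_exists (T : finType) (e : rel T) (tau : T -> nat)
    (M : {set T}) : dynamo e tau M ->
  exists k, smallest_dynamo_size e tau k /\ k <= #|M|.
Proof.
have [n] := ubnP #|M|; elim: n M => // n IHn M leMn dynM.
(* Descent on size; excluded middle decides whether a smaller dynamo exists. *)
have [[M' [dynM' ltM']]|noM'] :=
    classic (exists M', dynamo e tau M' /\ #|M'| < #|M|).
  have [k [kmin lek]] := IHn M' (leq_trans ltM' leMn) dynM'.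
  by exists k; split=> //; apply: leq_trans lek (ltnW ltM').
exists #|M|; split=> //; split; first by exists M.
move=> M' dynM'; rewrite leqNgt; apply/negP=> ltM'.
by apply: noM'; exists M'.
Qed.

Theorem theorem7 (T : finType) (e : rel T) :
  simple_digraph e ->
  strongly_connected e ->
  (exists k : nat,
     smallest_dynamo_size e (strict_majority e) k /\ k <= uphalf #|T|) /\
  ((exists v : T, odd (indeg e v)) ->
   exists M : {set T}, dynamo e (strict_majority e) M /\ 2 * #|M| <= #|T|).
Proof.
move=> [eI _] scon.
have splitr r : splittable e (~: [set r]).
  by apply: splittable_setC => //; rewrite inE.
split.
  have [M [dynM leM]] : exists M : {set T},
      dynamo e (strict_majority e) M /\ 2 * #|M| <= #|T|.+1.
    have [r _|T0] := pickP T.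
      have [M [dynM leM]] := splittable_dynamo (splitr r).
      by exists M; split=> //; have := cardsC1 r; lia.
    (* With no vertex to serve as [r], the whole (empty) vertex set is taken. *)
    exists (~: set0); split; first exact/activable_dynamo/activable0.
    by rewrite setC0 cardsT (eq_card0 T0).
  have [k [kmin lek]] := smallest_dynamo_exists dynM.
  by exists k; split=> //; lia.
case=> r oddr.
have : splittable e (r |: ~: [set r]).
  by apply: splittableU1 => //; [rewrite !inE eqxx | right].
rewrite setUCr => /splittable_dynamo[M [dynM leM]].
by exists M; split=> //; move: leM; rewrite cardsT; lia.
Qed.
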